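(* Let $\mathbf A$ be a finitely subdirectly irreducible De Morgan monoid. Then exactly one of the following holds: (1) $\mathbf A$ is a Sugihara monoid; or (2) the interval $[\neg(f^2),f^2]$ is the universe of a nontrivial anti-idempotent subalgebra $\mathbf A'$ of $\mathbf A$, the quotient $\mathbf S:=\mathbf A/[\neg(f^2))$ is a totally ordered odd Sugihara monoid, and $\mathbf A\cong\mathbf S[\mathbf A']$.
   Context: An involutive residuated lattice (IRL) is an algebra $\langle A;\cdot,\wedge,\vee,\neg,e\rangle$ with $\langle A;\cdot,e\rangle$ a commutative monoid, $\langle A;\wedge,\vee\rangle$ a lattice, $\neg\neg x=x$, and $x\cdot y\leqslant z\iff\neg z\cdot y\leqslant\neg x$. Define $x\to y:=\neg(x\cdot\neg y)$, $f:=\neg e$, $f^2:=f\cdot f$. A De Morgan monoid is an IRL with distributive lattice satisfying $x\leqslant x\cdot x$; anti-idempotent if it satisfies $x\leqslant f^2$. A Sugihara monoid is a De Morgan monoid with $a\cdot a=a$ for all $a$; odd if $f=e$. FSI: the identity congruence is meet-irreducible in the congruence lattice. $[\neg(f^2))=\{a:\neg(f^2)\leqslant a\}$; for a deductive filter (lattice filter containing $e$, closed under $\cdot$) $G$, $\mathbf A/G$ is the quotient by $\{\langle a,b\rangle:a\to b,\ b\to a\in G\}$. Rigorous extension: for a De Morgan monoid $\mathbf B$ and totally ordered odd Sugihara monoid $\mathbf S$ (disjoint), $\mathbf S[\mathbf B]$ has universe $(S\setminus\{e^{\mathbf S}\})\cup B$, neutral element $e^{\mathbf B}$, operations $\neg,\star$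 ($\star\in\{\wedge,\vee,\cdot\}$) agreeing with those of $\mathbf S$ on $S\setminus\{e^{\mathbf S}\}$ and of $\mathbf B$ on $B$, and for $s\in S\setminus\{e^{\mathbf S}\}$, $b\in B$: $b\star s=s\star b=b$ if $e^{\mathbf S}\star^{\mathbf S}s=e^{\mathbf S}$, and $=e^{\mathbf S}\star^{\mathbf S}s$ otherwise. *)

(* Defs.v *)
From mathcomp Require Import all_boot.
From mathcomp Require Import boolp classical_sets.

Set Implicit Arguments.
Unset Strict Implicit.
Unset Printing Implicit Defensive.

Declare Scope alg_scope.
Delimit Scope alg_scope with alg.

(* Signature only: the axioms are predicates below, so that subalgebras,
   quotients and rigorous extensions are formed at the level of raw algebras.
   Under the classical axioms of [boolp] every type carries a [choiceType]
   structure, so the choice of carrier is no restriction. *)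
Record algebra := Algebra {
  carrier :> choiceType;
  amul : carrier -> carrier -> carrier;
  ameet : carrier -> carrier -> carrier;
  ajoin : carrier -> carrier -> carrier;
  aneg : carrier -> carrier;
  aunit : carrier }.

Arguments amul {_} _ _.
Arguments ameet {_} _ _.
Arguments ajoin {_} _ _.
Arguments aneg {_} _.
Arguments aunit {_}.

Definition ale (A : algebra) (x y : A) : Prop := ameet x y = x.
Definition aimp (A : algebra) (x y : A) : A := aneg (amul x (aneg y)).
Definition af (A : algebra) : A := aneg aunit.
Definition af2 (A : algebra) : A := amul (af A) (af A).

Arguments af {_}.
Arguments af2 {_}.

Notation "x * y" := (amul x y) : alg_scope.
Notation "x `&` y" := (ameet x y) : alg_scope.
Notation "x `|` y" := (ajoin x y) : alg_scope.
Notation "x <= y" := (ale x y) : alg_scope.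

Local Open Scope quotient_scope.
Local Open Scope alg_scope.

Record is_lattice (A : algebra) : Prop := IsLattice {
  latIA : associative (@ameet A);
  latIC : commutative (@ameet A);
  latUA : associative (@ajoin A);
  latUC : commutative (@ajoin A);
  latIU : forall x y : A, x `&` (x `|` y) = x;
  latUI : forall x y : A, x `|` (x `&` y) = x }.

Record is_IRL (A : algebra) : Prop := IsIRL {
  irlMA : associative (@amul A);
  irlMC : commutative (@amul A);
  irl1M : left_id aunit (@amul A);
  irl_lattice : is_lattice A;
  irlNK : involutive (@aneg A);
  irl_res : forall x y z : A, x * y <= z <-> aneg z * y <= aneg x }.

Record is_DeMorgan (A : algebra) : Prop := IsDeMorgan {
  dm_IRL : is_IRL A;
  dm_distr : forall x y z : A, x `&` (y `|` z) = (x `&` y) `|` (x `&` z);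
  dm_sqinc : forall x : A, x <= x * x }.

Definition anti_idempotent (A : algebra) : Prop := forall x : A, x <= af2.

Definition is_Sugihara (A : algebra) : Prop :=
  is_DeMorgan A /\ (forall a : A, a * a = a).

Definition is_odd (A : algebra) : Prop := @af A = aunit.

Definition totally_ordered (A : algebra) : Prop :=
  forall x y : A, x <= y \/ y <= x.

Definition nontrivial (A : algebra) : Prop := exists x y : A, x <> y.

Record isomorphism (A B : algebra) (phi : A -> B) : Prop := Isomorphism {
  iso_bij : bijective phi;
  isoM : {morph phi : x y / x * y >-> x * y};
  isoI : {morph phi : x y / x `&` y >-> x `&` y};
  isoU : {morph phi : x y / x `|` y >-> x `|` y};
  isoN : {morph phi : x / aneg x >-> aneg x};
  iso1 : phi aunit = aunit }.

Definition isomorphic (A B : algebra) : Prop :=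
  exists phi : A -> B, isomorphism phi.

Record congruence (A : algebra) (th : A -> A -> Prop) : Prop := Congruence {
  cong_refl : forall x, th x x;
  cong_sym : forall x y, th x y -> th y x;
  cong_trans : forall x y z, th x y -> th y z -> th x z;
  congM : forall x x' y y', th x x' -> th y y' -> th (x * y) (x' * y');
  congI : forall x x' y y', th x x' -> th y y' -> th (x `&` y) (x' `&` y');
  congU : forall x x' y y', th x x' -> th y y' -> th (x `|` y) (x' `|` y');
  congN : forall x x', th x x' -> th (aneg x) (aneg x') }.

(* Meets in the congruence lattice are intersections.  Trivial algebras
   satisfy this definition. *)
Definition FSI (A : algebra) : Prop :=
  forall th ps : A -> A -> Prop, congruence th -> congruence ps ->
    (forall x y, th x y /\ ps x y <-> x = y) ->
    (forall x y, th x y <-> x = y) \/ (forall x y, ps x y <-> x = y).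

Section Subalgebra.
Variables (A : algebra).

Record subuniverse (X : set A) : Prop := Subuniverse {
  sub1 : X aunit;
  subM : forall x y, X x -> X y -> X (x * y);
  subI : forall x y, X x -> X y -> X (x `&` y);
  subU : forall x y, X x -> X y -> X (x `|` y);
  subN : forall x, X x -> X (aneg x) }.

Variables (X : set A) (hX : subuniverse X).

Definition subalgebra : algebra := {|
  carrier := set_type X;
  amul := fun x y => SigSub (mem_set (subM hX (set_valP x) (set_valP y)));
  ameet := fun x y => SigSub (mem_set (subI hX (set_valP x) (set_valP y)));
  ajoin := fun x y => SigSub (mem_set (subU hX (set_valP x) (set_valP y)));
  aneg := fun x => SigSub (mem_set (subN hX (set_valP x)));
  aunit := SigSub (mem_set (sub1 hX)) |}.

End Subalgebra.

Section Quotient.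
Variables (A : algebra) (th : A -> A -> Prop) (hth : congruence th).

Let r : rel A := fun x y => `[< th x y >].

Lemma congr_refl : reflexive r.
Proof. by move=> x; apply/asboolP/(cong_refl hth). Qed.

Lemma congr_sym : symmetric r.
Proof.
by move=> x y; apply/asboolP/asboolP; apply: (cong_sym hth).
Qed.

Lemma congr_trans : transitive r.
Proof.
move=> y x z /asboolP xy /asboolP yz; apply/asboolP.
exact: (cong_trans hth) xy yz.
Qed.

Definition congr_equiv : equiv_rel A :=
  EquivRel r congr_refl congr_sym congr_trans.

(* The operations are computed on representatives; the lemmas below show that
   the projection is a homomorphism, i.e. the choice is immaterial. *)
Definition quotient : algebra := {|
  carrier := {eq_quot congr_equiv};
  amul := fun x y => \pi_({eq_quot congr_equiv}) (repr x * repr y);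
  ameet := fun x y => \pi_({eq_quot congr_equiv}) (repr x `&` repr y);
  ajoin := fun x y => \pi_({eq_quot congr_equiv}) (repr x `|` repr y);
  aneg := fun x => \pi_({eq_quot congr_equiv}) (aneg (repr x));
  aunit := \pi_({eq_quot congr_equiv}) aunit |}.

Definition quotient_pi (x : A) : quotient := \pi_({eq_quot congr_equiv}) x.

Lemma quotient_piP (x y : A) : quotient_pi x = quotient_pi y <-> th x y.
Proof.
split=> [/eqmodP/asboolP //|h]; apply/eqmodP; exact/asboolP.
Qed.

Lemma quotient_pi_surj (u : quotient) : exists x, quotient_pi x = u.
Proof. by exists (repr (u : {eq_quot congr_equiv})); exact: reprK. Qed.

Lemma repr_pi (x : A) : th (repr (quotient_pi x : {eq_quot congr_equiv})) x.
Proof. by apply/quotient_piP; exact: reprK. Qed.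

Lemma quotient_piM : {morph quotient_pi : x y / x * y >-> x * y}.
Proof.
by move=> x y; apply/quotient_piP/(cong_sym hth)/(congM hth); exact: repr_pi.
Qed.

Lemma quotient_piI : {morph quotient_pi : x y / x `&` y >-> x `&` y}.
Proof.
by move=> x y; apply/quotient_piP/(cong_sym hth)/(congI hth); exact: repr_pi.
Qed.

Lemma quotient_piU : {morph quotient_pi : x y / x `|` y >-> x `|` y}.
Proof.
by move=> x y; apply/quotient_piP/(cong_sym hth)/(congU hth); exact: repr_pi.
Qed.

Lemma quotient_piN : {morph quotient_pi : x / aneg x >-> aneg x}.
Proof.
by move=> x; apply/quotient_piP/(cong_sym hth)/(congN hth); exact: repr_pi.
Qed.

Lemma quotient_pi1 : quotient_pi aunit = aunit.
Proof. by []. Qed.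

End Quotient.

Record deductive_filter (A : algebra) (G : set A) : Prop := DeductiveFilter {
  df_up : forall x y, G x -> x <= y -> G y;
  dfI : forall x y, G x -> G y -> G (x `&` y);
  df1 : G aunit;
  dfM : forall x y, G x -> G y -> G (x * y) }.

Definition filter_rel (A : algebra) (G : set A) (a b : A) : Prop :=
  G (aimp a b) /\ G (aimp b a).

Definition up_set (A : algebra) (a : A) : set A := [set x | a <= x].

Definition interval (A : algebra) (a b : A) : set A :=
  [set x | a <= x /\ x <= b].

Section IRLTheory.
Variables (A : algebra) (hA : is_IRL A).
Implicit Types x y z : A.

Let hL := irl_lattice hA.

Lemma ale_refl x : x <= x.
Proof. by have := latIU hL x (x `&` x); rewrite (latUI hL). Qed.

Lemma ale_trans x y z : x <= y -> y <= z -> x <= z.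
Proof. by rewrite /ale => xy yz; rewrite -xy -(latIA hL) yz. Qed.

Lemma ale_anti x y : x <= y -> y <= x -> x = y.
Proof. by rewrite /ale => xy yx; rewrite -xy (latIC hL) yx. Qed.

Lemma aleIl x y : x `&` y <= x.
Proof. by rewrite /ale (latIC hL) (latIA hL) (ale_refl x). Qed.

Lemma aleIr x y : x `&` y <= y.
Proof. by rewrite (latIC hL); exact: aleIl. Qed.

Lemma aleI z x y : z <= x -> z <= y -> z <= x `&` y.
Proof. by rewrite /ale => zx zy; rewrite (latIA hL) zx. Qed.

Lemma aleUl x y : x <= x `|` y.
Proof. exact: latIU hL _ _. Qed.

Lemma aleUr x y : y <= x `|` y.
Proof. by rewrite (latUC hL); exact: aleUl. Qed.

Lemma aleEU x y : x <= y <-> x `|` y = y.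
Proof.
rewrite /ale; split=> [<-|<-]; last exact: latIU.
by rewrite (latUC hL) (latIC hL) latUI.
Qed.

Lemma aleU z x y : x <= z -> y <= z -> x `|` y <= z.
Proof.
move=> /aleEU xz /aleEU yz; apply/aleEU.
by rewrite -(latUA hL) yz xz.
Qed.

Lemma irlM1 x : x * aunit = x.
Proof. by rewrite (irlMC hA) (irl1M hA). Qed.

Lemma ale_neg x y : x <= y -> aneg y <= aneg x.
Proof.
by move=> xy; have := (irl_res hA x aunit y).1; rewrite !irlM1; apply.
Qed.

Lemma aimp_res x y z : x * y <= z <-> y <= aimp x z.
Proof.
have h1 := irl_res hA aunit y (aimp x z).
have h2 := irl_res hA (aneg z) (x * y) (aneg aunit).
move: h1 h2; rewrite /aimp !(irlNK hA) !(irl1M hA) => h1 h2.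
rewrite (irlMA hA) (irlMC hA (aneg z)) in h2.
by split=> [/h2 /h1 //|/h1 /h2].
Qed.

Lemma aleM2l z x y : x <= y -> z * x <= z * y.
Proof.
move=> xy; apply/aimp_res; apply: ale_trans xy _.
by apply/aimp_res; exact: ale_refl.
Qed.

Lemma aleM2r z x y : x <= y -> x * z <= y * z.
Proof. by move=> xy; rewrite !(irlMC hA _ z); exact: aleM2l. Qed.

Lemma aimpK x y : x * aimp x y <= y.
Proof. by apply/aimp_res; exact: ale_refl. Qed.

Lemma aimp_neg x y : aimp (aneg x) (aneg y) = aimp y x.
Proof. by rewrite /aimp (irlNK hA) (irlMC hA). Qed.

Lemma filter_congruence (G : set A) :
  deductive_filter G -> congruence (filter_rel G).
Proof.
move=> hG; have G1 := df1 hG.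
have tr x y z : G (aimp x y) -> G (aimp y z) -> G (aimp x z).
  move=> gxy gyz; apply: (df_up hG) (dfM hG gxy gyz) _.
  apply: (aimp_res _ _ _).1; rewrite (irlMA hA).
  exact: ale_trans (aleM2r _ (aimpK x y)) (aimpK y z).
have M x y z : G (aimp x y) -> G (aimp (x * z) (y * z)).
  move=> g; apply: (df_up hG) g _; apply: (aimp_res _ _ _).1.
  rewrite (irlMC hA x z) (irlMC hA y z) -(irlMA hA).
  exact: aleM2l (aimpK x y).
have eI x y z : x * (aimp x y `&` aunit) <= y /\ z * (aimp x y `&` aunit) <= z.
  split; first exact: ale_trans (aleM2l _ (aleIl _ _)) (aimpK x y).
  by rewrite -{2}(irlM1 z); exact: aleM2l (aleIr _ _).
have I x y z : G (aimp x y) -> G (aimp (x `&` z) (y `&` z)).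
  move=> g; apply: (df_up hG) (dfI hG g G1) _; apply: (aimp_res _ _ _).1.
  have [h1 h2] := eI x y z; apply: aleI.
  - exact: ale_trans (aleM2r _ (aleIl x z)) h1.
  - exact: ale_trans (aleM2r _ (aleIr x z)) h2.
have U x y z : G (aimp x y) -> G (aimp (x `|` z) (y `|` z)).
  move=> g; apply: (df_up hG) (dfI hG g G1) _; apply: (aimp_res _ _ _).1.
  have [h1 h2] := eI x y z; rewrite (irlMC hA); apply: (aimp_res _ _ _).2; apply: aleU.
  - by apply: (aimp_res _ _ _).1; rewrite (irlMC hA); exact: ale_trans h1 (aleUl _ _).
  - by apply: (aimp_res _ _ _).1; rewrite (irlMC hA); exact: ale_trans h2 (aleUr _ _).
have C2 (op : A -> A -> A) : commutative op ->
    (forall x y z, G (aimp x y) -> G (aimp (op x z) (op y z))) ->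
    forall x x' y y', filter_rel G x x' -> filter_rel G y y' ->
      filter_rel G (op x y) (op x' y').
  move=> opC h x x' y y' [a b] [c d]; split.
  - by apply: tr (h _ _ y a) _; rewrite !(opC x'); exact: h.
  - by apply: tr (h _ _ y' b) _; rewrite !(opC x); exact: h.
split.
- have e x : G (aimp x x).
    apply: (df_up hG) G1 _; apply: (aimp_res _ _ _).1; rewrite irlM1; exact: ale_refl.
  by move=> x; split.
- by move=> x y [].
- by move=> x y z [a b] [c d]; split; [exact: tr a c|exact: tr d b].
- exact: C2 (irlMC hA) M.
- exact: C2 (latIC hL) I.
- exact: C2 (latUC hL) U.
- by move=> x y [a b]; split; rewrite aimp_neg.
Qed.

Definition filter_quotient (G : set A) (hG : deductive_filter G) : algebra :=
  quotient (filter_congruence hG).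

End IRLTheory.

Lemma up_neg_f2_filter (A : algebra) (hA : is_DeMorgan A) :
  deductive_filter (up_set (aneg (@af2 A))).
Proof.
have h := dm_IRL hA.
have le1 : aneg (@af2 A) <= aunit.
  by rewrite -(irlNK h aunit); apply: (ale_neg h); exact: dm_sqinc hA _.
split=> [x y|x y| |x y] //.
- exact: ale_trans h _ _ _.
- exact: aleI h _ _ _.
- move=> hx hy; apply: (ale_trans h) (dm_sqinc hA _) _.
  exact: (ale_trans h) (aleM2r h _ hx) (aleM2l h _ hy).
Qed.

Section RigorousExtension.
Variables (S B : algebra).

(* The disjoint union of S minus its neutral element with B. *)
Definition rig_carrier : choiceType :=
  ({s : S | s != aunit} + carrier B)%type.

Definition rig_in (b : B) (x : S) : rig_carrier :=
  if insub x is Some s then inl s else inr b.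

(* In the [inl], [inl] case the default value [aunit] is never used when S is
   a totally ordered odd Sugihara monoid: see the lemmas below. *)
Definition rig_op (opS : S -> S -> S) (opB : B -> B -> B)
    (u v : rig_carrier) : rig_carrier :=
  match u, v with
  | inl s, inl t => rig_in aunit (opS (val s) (val t))
  | inl s, inr b => rig_in b (opS aunit (val s))
  | inr b, inl s => rig_in b (opS aunit (val s))
  | inr b, inr c => inr (opB b c)
  end.

Definition rig_neg (u : rig_carrier) : rig_carrier :=
  match u with
  | inl s => rig_in aunit (aneg (val s))
  | inr b => inr (aneg b)
  end.

Definition rigorous_extension : algebra := {|
  carrier := rig_carrier;
  amul := rig_op amul amul;
  ameet := rig_op ameet ameet;
  ajoin := rig_op ajoin ajoin;
  aneg := rig_neg;
  aunit := inr aunit |}.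

Lemma rig_in_unit (b : B) : rig_in b aunit = inr b.
Proof. by rewrite /rig_in insubF // eqxx. Qed.

Lemma rig_in_neq (b : B) (x : S) (hx : x != aunit) :
  rig_in b x = inl (exist _ x hx).
Proof. by rewrite /rig_in insubT. Qed.

Hypotheses (hS : is_Sugihara S) (hodd : is_odd S) (htot : totally_ordered S).

Let hI : is_IRL S := dm_IRL hS.1.

Lemma rig_closedM (s t : S) : s != aunit -> t != aunit -> s * t != aunit.
Proof.
move=> s1 _; apply: contra_neq s1 => st.
by rewrite -[LHS](irlM1 hI) -st (irlMA hI) hS.2.
Qed.

Lemma rig_closedI (s t : S) : s != aunit -> t != aunit -> s `&` t != aunit.
Proof.
have hL := irl_lattice hI.
by move=> s1 t1; case: (htot s t) => [->|] //; rewrite (latIC hL) => ->.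
Qed.

Lemma rig_closedU (s t : S) : s != aunit -> t != aunit -> s `|` t != aunit.
Proof.
have hL := irl_lattice hI.
move=> s1 t1; case: (htot s t) => /(aleEU hI) => [->|] //.
by rewrite (latUC hL) => ->.
Qed.

Lemma rig_closedN (s : S) : s != aunit -> aneg s != aunit.
Proof. by apply: contra_neq => s1; rewrite -(irlNK hI s) s1. Qed.

End RigorousExtension.

(* Main.v *)
Require Import Defs.
From mathcomp Require Import all_boot.
From mathcomp Require Import boolp classical_sets.

(** Finite subdirect irreducibility makes [e] join-prime.  Since
    [e <= x \/ ~x] in every De Morgan monoid, each [x] satisfies [e <= x] or
    [x <= f].  If [f <= e] this forces idempotence.  Otherwise [e <= f^2], and
    with [n := ~(f^2) = f -> e] the dichotomy applied to [x -> f^2] shows that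
    an [x] not below [f^2] satisfies [e <= n * x]; from [n * f <= n] one then
    gets [f^2 <= x], [x * x = x] and [n * x = x].  Hence the congruence of the
    filter [[n)] collapses the interval [[n, f^2]] to one class and nothing
    else, so that [A] is the quotient with the neutral class blown up to that
    interval. *)

Set Implicit Arguments.
Unset Strict Implicit.
Unset Printing Implicit Defensive.

Local Open Scope alg_scope.

(** * De Morgan monoids: residuation, negative elements and powers of [f] *)

Section DeMorganTheory.
Variables (A : algebra) (hA : is_DeMorgan A).
Implicit Types x y z a : A.

Let hI : is_IRL A := dm_IRL hA.

Lemma aleM x x' y y' : x <= x' -> y <= y' -> x * y <= x' * y'.
Proof.
by move=> h k; apply: (ale_trans hI) (aleM2r hI _ h) (aleM2l hI _ k).
Qed.

Lemma ale_negV x y : aneg x <= aneg y -> y <= x.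
Proof. by move=> /(ale_neg hI); rewrite !(irlNK hI). Qed.

Lemma amul_le_f x y : x * y <= af <-> y <= aneg x.
Proof.
have := aimp_res hI x y af.
by rewrite /aimp /af (irlNK hI) (irlM1 hI).
Qed.

Lemma amulN_le_f x : x * aneg x <= af.
Proof. by apply: (amul_le_f _ _).2; exact: ale_refl hI _. Qed.

Lemma negative_idem a : a <= aunit -> a * a = a.
Proof.
move=> a1; apply: (ale_anti hI); last exact: dm_sqinc hA _.
by rewrite -{3}(irlM1 hI a); exact: aleM2l.
Qed.

Lemma negative_up_set_filter a :
  a <= aunit -> deductive_filter (up_set a).
Proof.
move=> a1; split=> [x y|x y| |x y] //.
- exact: ale_trans hI _ _ _.
- exact: aleI hI _ _ _.
- by move=> hx hy; rewrite /up_set /= -(negative_idem a1); exact: aleM.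
Qed.

Lemma unit_le_aimp x y : aunit <= aimp x y <-> x <= y.
Proof. by have := aimp_res hI x aunit y; rewrite (irlM1 hI) => ->. Qed.

(** The negation [w] of the join lies below both [x] and [~x], so [w <= w * w <= x * ~x <= f]. *)
Lemma unit_le_joinN x : aunit <= x `|` aneg x.
Proof.
apply: ale_negV; apply: (ale_trans hI) (dm_sqinc hA _) _.
apply: (ale_trans hI) _ (amulN_le_f x).
apply: aleM; last by apply: (ale_neg hI); exact: aleUl.
by rewrite -{3}(irlNK hI x); apply: (ale_neg hI); exact: aleUr.
Qed.

Lemma f_le_f2 : @af A <= af2.
Proof. exact: dm_sqinc hA _. Qed.

Lemma neg_f2_le_unit : aneg (@af2 A) <= aunit.
Proof. by rewrite -(irlNK hI aunit); apply: (ale_neg hI); exact: f_le_f2. Qed.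

(** Since [n = f -> e], one has [n * f <= e]; as [n] is idempotent, [n * f = n * (n * f) <= n]. *)
Lemma neg_f2_mulf : aneg (@af2 A) * af <= aneg (@af2 A).
Proof.
have nf1 : aneg (@af2 A) * af <= aunit.
  rewrite -(irlNK hI aunit); apply: (amul_le_f _ _).1.
  by rewrite (irlMC hI (aneg af2)) (irlMA hI); exact: amulN_le_f.
rewrite -{1}(negative_idem neg_f2_le_unit) -(irlMA hI) -{3}(irlM1 hI (aneg af2)).
exact: aleM2l.
Qed.

Lemma neg_f2_mulf2 : aneg (@af2 A) * af2 <= aneg (@af2 A).
Proof.
rewrite /af2 (irlMA hI); apply: (ale_trans hI) _ neg_f2_mulf.
rewrite -[aneg (af * af)]/(aneg af2).
exact: (aleM2r hI _ neg_f2_mulf).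
Qed.

(** By residuation it suffices that [n * f^2 * f^2 <= f]: [n] absorbs one factor, and
    [n * f^2 <= f]. *)
Lemma f2_idem : @af2 A * af2 = af2.
Proof.
apply: (ale_anti hI); last exact: dm_sqinc hA _.
rewrite -{3}(irlNK hI af2); apply: (amul_le_f _ _).1; rewrite (irlMA hI).
apply: (ale_trans hI) (aleM2r hI _ neg_f2_mulf2) _.
by rewrite (irlMC hI); exact: amulN_le_f.
Qed.

Lemma up_set_rel_unit a b : filter_rel (up_set aunit) a b -> a = b.
Proof. by move=> [/unit_le_aimp ab /unit_le_aimp ba]; exact: (ale_anti hI ab ba). Qed.

(** By distributivity the join of [e /\ x] and [e /\ y] is [e], so the congruences of their
    principal filters intersect in the identity. One of them is then the identity, yet it relates
    [e] to the generator of its filter. *)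
Lemma FSI_unit_join_prime x y :
  FSI A -> aunit <= x `|` y -> aunit <= x \/ aunit <= y.
Proof.
move=> hFSI xy.
have fx := negative_up_set_filter (aleIl hI aunit x).
have fy := negative_up_set_filter (aleIl hI aunit y).
have e_sub a : (forall u v, filter_rel (up_set (aunit `&` a)) u v <-> u = v) ->
    aunit <= a.
  move=> h; have /h -> : filter_rel (up_set (aunit `&` a)) aunit (aunit `&` a).
    split; rewrite /up_set /=.
      rewrite /aimp (irl1M hI) (irlNK hI); exact: ale_refl hI _.
    apply: (ale_trans hI) (aleIl hI _ _) _; apply: (unit_le_aimp _ _).2.
    exact: aleIl.
  exact: aleIr.
case: (hFSI _ _ (filter_congruence hI fx) (filter_congruence hI fy)).
- move=> u v; split=> [[[a b] [c d]]|<-]; last first.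
    by split; apply: cong_refl; exact: filter_congruence.
  have e1 : (aunit `&` x) `|` (aunit `&` y) = aunit.
    by rewrite -(dm_distr hA).
  by apply: up_set_rel_unit; split; rewrite /up_set /= -e1; apply: (aleU hI).
- by move=> /e_sub; left.
- by move=> /e_sub; right.
Qed.

Lemma f_le_unit_of_idem : (forall a, a * a = a) -> @af A <= aunit.
Proof.
move=> idem; rewrite -(irlNK hI aunit); apply: (amul_le_f _ _).1.
by rewrite idem; exact: ale_refl hI _.
Qed.

(** * Consequences of finite subdirect irreducibility *)

Section FSITheory.
Hypothesis hFSI : FSI A.

Lemma FSI_dichotomy x : aunit <= x \/ x <= af.
Proof.
case: (FSI_unit_join_prime hFSI (unit_le_joinN x)); first by left.
by move=> h; right; apply: ale_negV; rewrite /af (irlNK hI).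
Qed.

(** The dichotomy for [x -> y]: [e <= x -> y] means [x <= y], and [x -> y <= f] negates to
    [e <= x * ~y]. *)
Lemma FSI_aimp_dichotomy x y : x <= y \/ aunit <= x * aneg y.
Proof.
by case: (FSI_dichotomy (aimp x y)) => [/unit_le_aimp|/ale_negV]; [left|right].
Qed.

(** If [e <= x], then [~x] is negative, hence idempotent, and [~x * x = ~x * (~x * x) <= ~x * e];
    residuation turns this into [x * x <= x]. *)
Lemma FSI_Sugihara : @af A <= aunit -> is_Sugihara A.
Proof.
move=> fe; split=> // x.
case: (FSI_dichotomy x) => [ex|xf]; last first.
  by apply: negative_idem; exact: (ale_trans hI xf fe).
have Nx1 : aneg x <= aunit.
  by apply: (ale_trans hI) fe; apply: (ale_neg hI).
apply: (ale_anti hI); last exact: dm_sqinc hA _.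
rewrite -{3}(irlNK hI x) -amul_le_f (irlMA hI) (irlMC hI _ x).
apply: (amul_le_f _ _).2; rewrite -{1}(negative_idem Nx1) -(irlMA hI).
rewrite -{3}(irlM1 hI (aneg x)); apply: aleM2l => //.
by rewrite (irlMC hI); exact: (ale_trans hI (amulN_le_f x) fe).
Qed.

(** This makes the quotient by the filter of [n] idempotent. If [x <= f], then [n * x <= e]. If
    [e <= x], then [n * ~x] is negative, so it can be doubled, and the extra [n] brings [~x * x]
    below [e]. *)
Lemma neg_f2_mul_sqr x : aneg (@af2 A) * (x * x) <= x.
Proof.
set n := aneg _.
have nf y : y <= af -> n * y <= aunit.
  move=> yf; apply: (ale_trans hI) neg_f2_le_unit.
  by apply: (ale_trans hI) neg_f2_mulf; exact: aleM2l.
case: (FSI_dichotomy x) => [ex|xf].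
  have yf : aneg x <= af by apply: (ale_neg hI).
  have nyx : n * aneg x * x <= aneg x.
    rewrite -{1}(negative_idem (nf _ yf)) -(irlMA hI (n * aneg x)).
    rewrite -(irlMA hI n (aneg x) x) (irlMC hI (aneg x) x).
    have h := nf _ (amulN_le_f x).
    apply: (ale_trans hI) (aleM2l hI _ h) _; rewrite (irlM1 hI).
    rewrite -{2}(irl1M hI (aneg x)); apply: aleM2r => //.
    exact: neg_f2_le_unit.
  rewrite -{3}(irlNK hI x); apply: (amul_le_f _ _).1.
  rewrite (irlMA hI) (irlMC hI (aneg x)) (irlMA hI) (irlMC hI _ x).
  exact: (amul_le_f _ _).2.
rewrite (irlMA hI) -{3}(irl1M hI x); apply: aleM2r => //; exact: nf.
Qed.

(** * The interval [[n, f^2]] when [f] is not below [e] *)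

Hypothesis f_nle_unit : ~ @af A <= aunit.

(** Otherwise [f * f <= f], which residuates to [f <= ~f = e]. *)
Lemma unit_le_f2 : @aunit A <= af2.
Proof.
case: (FSI_dichotomy af2) => // /amul_le_f.
by rewrite {2}/af (irlNK hI).
Qed.

Lemma neg_f2_le_f : aneg (@af2 A) <= af.
Proof. by apply: (ale_neg hI); exact: unit_le_f2. Qed.

Lemma interval_f2_subuniverse :
  subuniverse (interval (aneg (@af2 A)) (@af2 A)).
Proof.
split.
- by split; [exact: neg_f2_le_unit|exact: unit_le_f2].
- move=> x y [nx xf] [ny yf]; split.
    by rewrite -(negative_idem neg_f2_le_unit); exact: aleM.
  by rewrite -f2_idem; exact: aleM.
- move=> x y [nx xf] [ny yf]; split; first exact: aleI.
  by apply: (ale_trans hI) xf; exact: aleIl.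
- move=> x y [nx xf] [ny yf]; split; last exact: aleU.
  by apply: (ale_trans hI) nx _; exact: aleUl.
- move=> x [nx xf]; split; first exact: (ale_neg hI xf).
  by rewrite -(irlNK hI af2); apply: (ale_neg hI).
Qed.

Lemma unit_le_mul_neg_f2 x : ~ x <= af2 -> aunit <= x * aneg af2.
Proof. by case: (FSI_aimp_dichotomy x af2). Qed.

(** Here [f^2 <= (x * n) * f^2 <= x], because [n * f^2 <= n <= e]. *)
Lemma f2_le x : ~ x <= af2 -> af2 <= x.
Proof.
move=> /unit_le_mul_neg_f2 h; rewrite -(irl1M hI af2).
apply: (ale_trans hI) (aleM2r hI _ h) _; rewrite -(irlMA hI).
rewrite -{2}(irlM1 hI x); apply: aleM2l => //.
exact: (ale_trans hI neg_f2_mulf2 neg_f2_le_unit).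
Qed.

(** From [e <= x * n] follows [x <= n * (x * x) = n * (n * (x * x))], whose inner product is at most
    [x]. *)
Lemma neg_f2_mul_fixed x : ~ x <= af2 -> x <= aneg af2 * x.
Proof.
move=> xf; have h := unit_le_mul_neg_f2 xf.
have h2 : x <= aneg af2 * (x * x).
  rewrite -{1}(irlM1 hI x) [aneg _ * _](irlMC hI) -(irlMA hI).
  exact: aleM2l.
apply: (ale_trans hI) h2 _.
rewrite -{1}(negative_idem neg_f2_le_unit) -(irlMA hI).
apply: aleM2l => //; exact: neg_f2_mul_sqr.
Qed.

Lemma neg_f2_filter_relP x y :
  filter_rel (up_set (aneg af2)) x y <->
  aneg af2 * x <= y /\ aneg af2 * y <= x.
Proof.
by rewrite /filter_rel /up_set /= -!(aimp_res hI) !(irlMC hI (aneg af2)).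
Qed.

(** An [x] in the class of [e] but not below [f^2] would give [f <= f^2 <= x <= n * x <= e]. *)
Lemma neg_f2_filter_rel_unit x :
  filter_rel (up_set (aneg af2)) x aunit <-> interval (aneg af2) af2 x.
Proof.
rewrite neg_f2_filter_relP (irlM1 hI); split=> -[].
  move=> nx1 nx; split=> //; apply: contrapT => xf; apply: f_nle_unit.
  apply: (ale_trans hI) (f_le_f2) _; apply: (ale_trans hI) (f2_le xf) _.
  exact: (ale_trans hI) (neg_f2_mul_fixed xf) nx1.
move=> nx xf; split=> //.
apply: (ale_trans hI) neg_f2_le_unit.
by apply: (ale_trans hI) neg_f2_mulf2; exact: aleM2l.
Qed.

Let th := filter_congruence hI (up_neg_f2_filter hA).

Lemma neg_f2_filter_rel_eq x y :
  filter_rel (up_set (aneg af2)) x y ->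
  ~ interval (aneg af2) af2 x -> x = y.
Proof.
have above (u v : A) : filter_rel (up_set (aneg af2)) u v -> ~ u <= af2 -> u = v.
  move=> /neg_f2_filter_relP[uv vu] uf.
  have {}uv := ale_trans hI (neg_f2_mul_fixed uf) uv.
  apply: (ale_anti hI) => //; apply: (ale_trans hI) _ vu.
  by apply: neg_f2_mul_fixed => vf; apply: uf; exact: (ale_trans hI uv vf).
move=> xy xI; have [xf|] := pselect (x <= af2); last exact: above.
(* Now [x] is not above [n], so [~x] is not below [f^2] and the first case applies to the
   negations. *)
rewrite -(irlNK hI x) -(irlNK hI y); congr aneg.
apply: above; first exact: (congN th).
move=> Nxf; apply: xI; split=> //.
by apply: ale_negV; rewrite (irlNK hI).
Qed.

(** An element outside the interval lies above [f^2] or, by negation, below [n]. *)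
Lemma interval_comparable x y :
  interval (aneg af2) af2 x -> ~ interval (aneg af2) af2 y ->
  x <= y \/ y <= x.
Proof.
move=> [nx xf] yI; have [yf|/f2_le fy] := pselect (y <= af2); last first.
  by left; exact: (ale_trans hI xf fy).
right; apply: (ale_trans hI) _ nx; apply: ale_negV; rewrite (irlNK hI).
apply: f2_le => Nyf; apply: yI; split=> //.
by apply: ale_negV; rewrite (irlNK hI).
Qed.

(** Linearity of the quotient, expressed in [A]. An element outside the interval is comparable with
    every element; for two inside, [n * x <= n * f^2 <= n <= y]. *)
Lemma neg_f2_mul_total x y : aneg af2 * x <= y \/ aneg af2 * y <= x.
Proof.
have le (u v : A) : u <= v -> aneg af2 * u <= v.
  move=> uv; rewrite -(irl1M hI v).
  by apply: aleM => //; exact: neg_f2_le_unit.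
have above (u v : A) : ~ u <= af2 -> u <= v \/ v <= u.
  move=> uf; case: (FSI_aimp_dichotomy u v) => [|h]; [by left|right].
  (* As [u <= n * u] and [n * f <= n], [u] absorbs [f]; then [v <= u * ~v * v <= u * f <= u]. *)
  have fu : u * af <= u.
    apply: (ale_trans hI) (aleM2r hI _ (neg_f2_mul_fixed uf)) _.
    rewrite -(irlMA hI) (irlMC hI u) (irlMA hI).
    apply: (ale_trans hI) (aleM2r hI _ neg_f2_mulf) _.
    by apply: le; exact: ale_refl hI _.
  apply: (ale_trans hI) fu; rewrite -(irl1M hI v).
  apply: (ale_trans hI) (aleM2r hI _ h) _; rewrite -(irlMA hI).
  by apply: aleM2l => //; rewrite (irlMC hI); exact: amulN_le_f.
have outside (u v : A) : ~ interval (aneg af2) af2 u -> u <= v \/ v <= u.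
  move=> uI; have [uf|] := pselect (u <= af2); last exact: above.
  have /(above _ (aneg v)) : ~ aneg u <= af2.
    move=> Nuf; apply: uI; split=> //.
    by apply: ale_negV; rewrite (irlNK hI).
  by move=> [] /ale_negV; [right|left].
have [xI|/(outside x y)[]] := pselect (interval (aneg af2) af2 x);
  [|by move/le; left|by move/le; right].
have [[ny _]|/(outside y x)[]] := pselect (interval (aneg af2) af2 y);
  [|by move/le; right|by move/le; left].
left; apply: (ale_trans hI) ny; apply: (ale_trans hI) neg_f2_mulf2.
by apply: aleM2l => //; exact: xI.2.
Qed.

End FSITheory.
End DeMorganTheory.

(** * Quotients of De Morgan monoids by deductive filters *)

Section FilterQuotient.
Variables (A : algebra) (hA : is_DeMorgan A).
Variables (G : set A) (hG : deductive_filter G).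

Let hI : is_IRL A := dm_IRL hA.
Let th := filter_congruence hI hG.
Let Q := filter_quotient hI hG.
Let p : A -> Q := quotient_pi th.

Lemma filter_quotient_le (x y : A) : (p x <= p y) <-> G (aimp x y).
Proof.
rewrite /ale /p -quotient_piI quotient_piP; split=> [[_]|g].
  move=> g; apply: (df_up hG) g _; apply: (aimp_res hI _ _ _).1.
  exact: (ale_trans hI) (aimpK hI _ _) (aleIr hI _ _).
split.
  apply: (df_up hG) (df1 hG) _; apply: (unit_le_aimp hA _ _).2; exact: aleIl.
(* Meeting [x -> y] with [e] stays in [G] and keeps the product with [x] below [x] as well as below
   [y]. *)
apply: (df_up hG) (dfI hG g (df1 hG)) _; apply: (aimp_res hI _ _ _).1.
apply: (aleI hI).
  by rewrite -{3}(irlM1 hI x); apply: aleM2l => //; exact: aleIr.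
apply: (ale_trans hI) (aimpK hI x y); apply: aleM2l => //; exact: aleIl.
Qed.

Lemma filter_quotient_DeMorgan : is_DeMorgan Q.
Proof.
have hL := irl_lattice hI.
have surj (u : Q) : exists x, p x = u by exact: quotient_pi_surj.
have pM x y : p x * p y = p (x * y) by rewrite /p quotient_piM.
have pIm x y : p x `&` p y = p (x `&` y) by rewrite /p quotient_piI.
have pU x y : p x `|` p y = p (x `|` y) by rewrite /p quotient_piU.
have pN x : aneg (p x) = p (aneg x) by rewrite /p quotient_piN.
split; first split.
- move=> u v w; have [x <-] := surj u; have [y <-] := surj v.
  by have [z <-] := surj w; rewrite !pM (irlMA hI).
- move=> u v; have [x <-] := surj u; have [y <-] := surj v.
  by rewrite !pM (irlMC hI).
- by move=> u; have [x <-] := surj u; rewrite -(quotient_pi1 th) pM (irl1M hI).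
- split.
  + move=> u v w; have [x <-] := surj u; have [y <-] := surj v.
    by have [z <-] := surj w; rewrite !pIm (latIA hL).
  + move=> u v; have [x <-] := surj u; have [y <-] := surj v.
    by rewrite !pIm (latIC hL).
  + move=> u v w; have [x <-] := surj u; have [y <-] := surj v.
    by have [z <-] := surj w; rewrite !pU (latUA hL).
  + move=> u v; have [x <-] := surj u; have [y <-] := surj v.
    by rewrite !pU (latUC hL).
  + move=> u v; have [x <-] := surj u; have [y <-] := surj v.
    by rewrite !pU !pIm (latIU hL).
  + move=> u v; have [x <-] := surj u; have [y <-] := surj v.
    by rewrite !pIm !pU (latUI hL).
- by move=> u; have [x <-] := surj u; rewrite !pN (irlNK hI).
- move=> u v w; have [x <-] := surj u; have [y <-] := surj v.
  (* Both inequalities say that [~(x * y * ~z)] belongs to [G]. *)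
  have [z <-] := surj w; rewrite !pN !pM !filter_quotient_le /aimp (irlNK hI).
  by rewrite [aneg z * y * x](irlMC hI) (irlMC hI (aneg z)) (irlMA hI).
- move=> u v w; have [x <-] := surj u; have [y <-] := surj v.
  by have [z <-] := surj w; rewrite !(pU, pIm) (dm_distr hA).
- move=> u; have [x <-] := surj u; rewrite pM; apply/filter_quotient_le.
  apply: (df_up hG) (df1 hG) _; apply: (unit_le_aimp hA _ _).2; exact: dm_sqinc hA _.
Qed.

End FilterQuotient.

Lemma rig_in_irrel (S B : algebra) (b c : B) (s : S) :
  s != aunit -> rig_in b s = rig_in c s.
Proof. by move=> s1; rewrite !rig_in_neq. Qed.

(** * The isomorphism onto the rigorous extension *)

Section Decomposition.
Variables (A : algebra) (hA : is_DeMorgan A) (hFSI : FSI A).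
Hypothesis f_nle_unit : ~ @af A <= aunit.

Let hI : is_IRL A := dm_IRL hA.
Let th := filter_congruence hI (up_neg_f2_filter hA).
Let S := filter_quotient hI (up_neg_f2_filter hA).
Let p : A -> S := quotient_pi th.
Let X : set A := interval (aneg af2) af2.

Variable hsub : subuniverse X.
Let A' := subalgebra hsub.

Lemma quotient_f2_Sugihara : is_Sugihara S.
Proof.
split=> [|u]; first exact: filter_quotient_DeMorgan.
have [x <-] := quotient_pi_surj u; rewrite -quotient_piM.
apply/quotient_piP/neg_f2_filter_relP => //; split.
  exact: neg_f2_mul_sqr.
apply: (ale_trans hI) (dm_sqinc hA _); rewrite -{2}(irl1M hI x).
by apply: aleM2r => //; exact: neg_f2_le_unit.
Qed.

Lemma quotient_f2_unitP (x : A) : p x = aunit <-> X x.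
Proof.
by rewrite -(quotient_pi1 th) quotient_piP neg_f2_filter_rel_unit.
Qed.

Lemma quotient_f2_odd : is_odd S.
Proof.
rewrite /is_odd /af -(quotient_pi1 th) -quotient_piN; apply/quotient_f2_unitP.
by split; [exact: neg_f2_le_f|exact: f_le_f2].
Qed.

Lemma quotient_f2_total : totally_ordered S.
Proof.
move=> u v; have [x <-] := quotient_pi_surj u.
have [y <-] := quotient_pi_surj v.
rewrite !filter_quotient_le /up_set /= -!(aimp_res hI) !(irlMC hI _ (aneg af2)).
exact: neg_f2_mul_total.
Qed.

Lemma quotient_f2_inj (x y : A) : p x != aunit -> p x = p y -> x = y.
Proof.
move=> /eqP x1 /quotient_piP xy; apply: (neg_f2_filter_rel_eq hA) xy _ => //.
by move=> /quotient_f2_unitP.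
Qed.

(* The first argument of [rig_in] matters only when [p x] is the neutral
   class, i.e. when [x] lies in [X]; the default of [insubd] is never used. *)
Definition rig_map (x : A) : rigorous_extension S A' :=
  rig_in (insubd (aunit : A') x : A') (p x).

Lemma rig_map_in (x : A') : rig_map (val x) = inr x.
Proof.
have /quotient_f2_unitP px := set_valP x.
by rewrite /rig_map px rig_in_unit valKd.
Qed.

Lemma rig_map_out (x : A) (b : A') : p x != aunit -> rig_map x = rig_in b (p x).
Proof. exact: rig_in_irrel. Qed.

Variant rig_map_spec (x : A) : rig_carrier S A' -> Prop :=
| RigMapIn (b : A') of x = val b & p x = aunit : rig_map_spec x (inr b)
| RigMapOut (px : p x != aunit) : rig_map_spec x (inl (exist _ (p x) px)).

Lemma rig_mapP (x : A) : rig_map_spec x (rig_map x).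
Proof.
have [px|px] := eqVneq (p x) aunit.
  have xX : x \in X by apply/mem_set/quotient_f2_unitP.
  have -> : x = val (SigSub xX : A') by [].
  by rewrite rig_map_in; constructor.
by rewrite (rig_map_out aunit px) rig_in_neq; constructor.
Qed.

(** Elements of the interval are kept as they are, and every other class is a singleton. *)
Lemma rig_map_bij : bijective rig_map.
Proof.
have surj (u : rigorous_extension S A') : exists x, rig_map x = u.
  case: u => [[s s1]|b]; last by exists (val b); exact: rig_map_in.
  have [x xs] := quotient_pi_surj s; exists x.
  have px : p x != aunit by rewrite /p xs.
  rewrite (rig_map_out aunit px) rig_in_neq; congr inl.
  exact: val_inj.
have inj : injective rig_map.
  move=> x y; case: (rig_mapP x) => [b -> _|px]; case: (rig_mapP y) => [c -> _|py] //.
    by move=> [->].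
  by move=> [] /(quotient_f2_inj px).
pose g u := projT1 (cid (surj u)).
have gK : cancel g rig_map by move=> u; exact: projT2 (cid (surj u)).
by exists g => // x; apply: inj; rewrite gK.
Qed.

(** One argument for product, meet and join. The last premise matches the two clauses of the
    rigorous extension for mixed arguments: the result is the interval element itself or leaves the
    interval. *)
Lemma rig_map_op (opA : A -> A -> A) (opS : S -> S -> S) (opB : A' -> A' -> A') :
  commutative opA ->
  {morph p : x y / opA x y >-> opS x y} ->
  {morph (val : A' -> A) : x y / opB x y >-> opA x y} ->
  (forall s t, s != aunit -> t != aunit -> opS s t != aunit) ->
  (forall x y, X x -> ~ X y -> opA x y = x \/ ~ X (opA x y)) ->
  {morph rig_map : x y / opA x y >-> rig_op opS opB x y}.
Proof.
move=> opAC pop vop closed mixed.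
have mix x y (b : A') : x = val b -> p x = aunit -> p y != aunit ->
    rig_map (opA x y) = rig_in b (opS aunit (p y)).
  move=> xb px /eqP py; rewrite -px -pop.
  have xX : X x by exact/quotient_f2_unitP.
  have yX : ~ X y by move=> /quotient_f2_unitP.
  have [e|nX] := mixed x y xX yX.
    by rewrite e px rig_in_unit xb rig_map_in.
  by apply: rig_map_out; apply/eqP => /quotient_f2_unitP.
move=> x y; case: (rig_mapP x) => [b xb px|px]; case: (rig_mapP y) => [c yc py|py] /=.
- by rewrite xb yc -vop rig_map_in.
- exact: mix.
- by rewrite opAC (mix y x c).
- by rewrite -pop; apply: rig_map_out; rewrite pop; exact: closed.
Qed.

Lemma rig_map_iso : isomorphism rig_map.
Proof.
have hL := irl_lattice hI.
have hS := quotient_f2_Sugihara; have hSI := dm_IRL hS.1.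
have htot := quotient_f2_total.
split.
- exact: rig_map_bij.
- apply: rig_map_op; [exact: irlMC|exact: quotient_piM|by []| |].
    exact: rig_closedM.
  (* The product has the class of [y], so it always leaves the interval. *)
  move=> x y /quotient_f2_unitP px yX; right=> /quotient_f2_unitP.
  rewrite /p quotient_piM -/p px (irl1M hSI).
  by move=> /quotient_f2_unitP.
- apply: rig_map_op; [exact: latIC|exact: quotient_piI|by []| |].
    exact: rig_closedI.
  move=> x y xX yX.
  (* Comparability makes the meet one of its two arguments. *)
  case: (interval_comparable hA hFSI xX yX) => [|yx]; first by left.
  by right; rewrite (latIC hL) yx.
- apply: rig_map_op; [exact: latUC|exact: quotient_piU|by []| |].
    exact: rig_closedU.
  move=> x y xX yX.
  case: (interval_comparable hA hFSI xX yX) => /(aleEU hI) e; first by right; rewrite e.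
  by left; rewrite (latUC hL).
- move=> x; case: (rig_mapP x) => [b -> _|px] /=.
    by rewrite -rig_map_in.
  have pN : p (aneg x) = aneg (p x) by exact: quotient_piN.
  rewrite (rig_map_out aunit) pN //; exact: (rig_closedN hS quotient_f2_odd).
- exact: (rig_map_in aunit).
Qed.

End Decomposition.

(** * The two alternatives exclude each other and exhaust all cases *)

Theorem theorem7p19 (A : algebra) (hA : is_DeMorgan A) (hFSI : FSI A) :
  let S := filter_quotient (dm_IRL hA) (up_neg_f2_filter hA) in
  let case1 := is_Sugihara A in
  let case2 :=
    exists hsub : subuniverse (interval (aneg (@af2 A)) (@af2 A)),
      let A' := subalgebra hsub in
      [/\ nontrivial A' /\ anti_idempotent A',
          [/\ is_Sugihara S, is_odd S & totally_ordered S]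
        & isomorphic A (rigorous_extension S A')] in
  (case1 /\ ~ case2) \/ (~ case1 /\ case2).
Proof.
move=> S case1 case2; have hI := dm_IRL hA.
have [c1|c1] := pselect case1; [left|right]; split=> //.
  move=> [hsub [[[x [y xy]] _] _ _]]; apply: xy.
  have fe := f_le_unit_of_idem hA c1.2.
  (* Idempotence turns the interval into [[e, f]], which [f <= e] shrinks to a point. *)
  have eq1 (z : subalgebra hsub) : val z = aunit.
    move: (val z) (set_valP z) => u [].
    rewrite /af2 c1.2 {1}/af (irlNK hI) => eu uf.
    by apply: (ale_anti hI) => //; exact: (ale_trans hI uf fe).
  by apply: val_inj; rewrite !eq1.
have nfe : ~ @af A <= aunit by move=> /(FSI_Sugihara hA hFSI).
exists (interval_f2_subuniverse hA hFSI nfe) => A'; split.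
- split; last by move=> x; apply: val_inj; exact: (set_valP x).2.
  (* These two differ because [f = e] would give [f <= e]. *)
  exists af, aunit => /(congr1 val) /= e; case: (nfe).
  by rewrite /af e; exact: ale_refl hI _.
- split; [exact: quotient_f2_Sugihara|exact: quotient_f2_odd|].
  exact: quotient_f2_total.
- by exists (rig_map hA (interval_f2_subuniverse hA hFSI nfe)); exact: rig_map_iso.
Qed.
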